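(* Assume that $\operatorname{cov}(\mathcal{M})=\mathfrak{b}=\mathfrak{d}$. Then (Setting (3.a)) there is a subgroup of $\mathbb{Z}^{\mathbb{N}}$ which is Hurewicz-bounded, Menger-bounded, and Rothberger-bounded, but has none of the Hurewicz, Menger, and Rothberger properties.
   Context: For $f,g\in\mathbb{N}^{\mathbb{N}}$, $f\le^* g$ means $f(n)\le g(n)$ for all but finitely many $n$. $\mathfrak{b}$ is the minimal cardinality of a $\le^*$-unbounded subset of $\mathbb{N}^{\mathbb{N}}$; $\mathfrak{d}$ is the minimal cardinality of a dominating $D\subseteq\mathbb{N}^{\mathbb{N}}$ (for each $g\in\mathbb{N}^{\mathbb{N}}$ there is $f\in D$ with $g\le^* f$); $\operatorname{cov}(\mathcal{M})$ is the minimal cardinality of a cover of $\mathbb{R}$ by meager sets, equivalently, of $Y\subseteq\mathbb{N}^{\mathbb{N}}$ such that there is no $f\in\mathbb{N}^{\mathbb{N}}$ with the property that for each $y\in Y$, $f(n)=y(n)$ for some $n$. The group $\mathbb{Z}^{\mathbb{N}}$ carries pointwise addition and the product topology ($\mathbb{Z}$ discrete); subgroups carry the subspace topology. For a topological group $(G,\cdot)$, with the condition required for each sequence $(U_n)_{n\in\mathbb{N}}$ of neighborhoods of the unit: $G$ is Menger-bounded if there are finite $F_n\subseteq G$ with $G=\bigcup_n F_n\cdot U_n$; Hurewicz-bounded if there are finite $F_n\subseteq G$ such that each $g\in G$ belongs to $F_n\cdot U_n$ for all but finitely many $n$; Rothberger-bounded if there are $a_n\in G$ with $G=\bigcup_n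 a_n\cdot U_n$. For a topological space $X$, with the condition required for each sequence $(\mathcal{U}_n)_{n\in\mathbb{N}}$ of open covers of $X$: $X$ has the Menger property if there are finite $\mathcal{F}_n\subseteq\mathcal{U}_n$ such that $\bigcup_n\mathcal{F}_n$ covers $X$; the Hurewicz property if there are finite $\mathcal{F}_n\subseteq\mathcal{U}_n$ such that each $x\in X$ belongs to $\bigcup_{U\in\mathcal{F}_n}U$ for all but finitely many $n$; the Rothberger property if there are $U_n\in\mathcal{U}_n$ with $X=\bigcup_n U_n$. *)

(* Defs.v *)
From HB Require Import structures.
From mathcomp Require Import all_boot all_order all_algebra.
From mathcomp Require Import all_classical all_reals all_analysis.

Set Implicit Arguments.
Unset Strict Implicit.
Unset Printing Implicit Defensive.

Import Order.TTheory GRing.Theory Num.Theory.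
Import numFieldNormedType.Exports.

Local Open Scope classical_set_scope.
Local Open Scope card_scope.
Local Open Scope ring_scope.

(* A cardinal invariant is handled through the sets that realize it: if
   [A] is [least_card P], then the minimal cardinality of a set satisfying
   [P] is that of [A]. *)
Definition least_card (T : Type) (P : set (set T)) (A : set T) : Prop :=
  P A /\ forall B, P B -> A #<= B.

Definition eventually_le (f g : nat -> nat) : Prop :=
  \forall n \near \oo, (f n <= g n)%N.

Definition unbounded (B : set (nat -> nat)) : Prop :=
  ~ exists g, forall f, B f -> eventually_le f g.

Definition dominating (D : set (nat -> nat)) : Prop :=
  forall g, exists2 f, D f & eventually_le g f.

Definition nowhere_dense (T : topologicalType) (A : set T) : Prop :=
  interior (closure A) = set0.

Definition meager (T : topologicalType) (A : set T) : Prop :=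
  exists2 F : nat -> set T,
    (forall n, nowhere_dense (F n)) & A = \bigcup_n F n.

Definition meager_cover (T : topologicalType) (C : set (set T)) : Prop :=
  (forall A, C A -> meager A) /\ \bigcup_(A in C) A = setT.

Section Covers.
Variable X : topologicalType.

Definition open_cover (C : set (set X)) : Prop :=
  (forall U, C U -> open U) /\ \bigcup_(U in C) U = setT.

Definition menger : Prop :=
  forall C : nat -> set (set X), (forall n, open_cover (C n)) ->
  exists F : nat -> set (set X),
    (forall n, finite_set (F n) /\ F n `<=` C n) /\
    \bigcup_n \bigcup_(U in F n) U = setT.

Definition hurewicz : Prop :=
  forall C : nat -> set (set X), (forall n, open_cover (C n)) ->
  exists F : nat -> set (set X),
    (forall n, finite_set (F n) /\ F n `<=` C n) /\
    forall x, \forall n \near \oo, (\bigcup_(U in F n) U) x.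

Definition rothberger : Prop :=
  forall C : nat -> set (set X), (forall n, open_cover (C n)) ->
  exists U : nat -> set X, (forall n, C n (U n)) /\ \bigcup_n U n = setT.

End Covers.

(* Only abelian groups are needed, so the group law is written additively. *)
Section Boundedness.
Variable G : topologicalZmodType.

Definition sumset (A B : set G) : set G := [set a + b | a in A & b in B].

Definition menger_bounded : Prop :=
  forall U : nat -> set G, (forall n, nbhs 0 (U n)) ->
  exists F : nat -> set G,
    (forall n, finite_set (F n)) /\ \bigcup_n sumset (F n) (U n) = setT.

Definition hurewicz_bounded : Prop :=
  forall U : nat -> set G, (forall n, nbhs 0 (U n)) ->
  exists F : nat -> set G,
    (forall n, finite_set (F n)) /\
    forall g, \forall n \near \oo, sumset (F n) (U n) g.

Definition rothberger_bounded : Prop :=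
  forall U : nat -> set G, (forall n, nbhs 0 (U n)) ->
  exists a : nat -> G, \bigcup_n sumset [set a n] (U n) = setT.

End Boundedness.

Definition ZN : Type := nat -> int.

HB.instance Definition _ := GRing.Zmodule.on ZN.
HB.instance Definition _ :=
  Topological.copy ZN (prod_topology (fun _ : nat => discrete_topology int)).

Lemma near_ZN_coord (x : ZN) (i : nat) : \forall y \near x, y i = x i.
Proof.
have /(_ [set x i]) := @proj_continuous nat
  (fun _ : nat => discrete_topology int) i x.
by apply; rewrite nbhs_principalE; exact/principal_filterP.
Qed.

Lemma ZN_sub_continuous : continuous (fun x : ZN * ZN => x.1 - x.2).
Proof.
move=> x; apply/cvg_sup => i U [_ [[V _ <-] Vx VU]].
apply: (@filterS _ _ _ (fun y : ZN * ZN => y.1 i = x.1 i /\ y.2 i = x.2 i)).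
  move=> y [y1 y2]; apply: VU => /=.
  by rewrite -[(y.1 - y.2) i]/(y.1 i - y.2 i) y1 y2.
by exists ([set z | z i = x.1 i], [set z | z i = x.2 i]);
  [split; exact: near_ZN_coord|move=> [? ?] []].
Qed.
HB.instance Definition _ :=
  PreTopologicalNmodule_isTopologicalZmodule.Build ZN ZN_sub_continuous.

Section Subgroup.
Variables (V : topologicalZmodType) (S : zmodClosed V).

Record subgroup := Subgroup { subgroup_val : V; _ : subgroup_val \in S }.

HB.instance Definition _ := [isSub for subgroup_val].
HB.instance Definition _ := [Choice of subgroup by <:].
HB.instance Definition _ := [SubChoice_isSubZmodule of subgroup by <:].
HB.instance Definition _ :=
  Topological.copy subgroup (initial_topology subgroup_val).

Lemma subgroup_sub_continuous :
  continuous (fun x : subgroup * subgroup => x.1 - x.2).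
Proof.
move=> x U [_ [[W oW <-] Wx WU]]; apply: (filterS WU).
have /= cval : continuous (subgroup_val : subgroup -> V).
  exact: initial_continuous.
have csub : continuous
    (fun y : subgroup * subgroup => subgroup_val y.1 - subgroup_val y.2).
  move=> y; apply: (@continuous_comp _ _ _
    (fun z : subgroup * subgroup => (subgroup_val z.1, subgroup_val z.2))
    (fun z : V * V => z.1 - z.2)); last exact: sub_continuous.
  apply: cvg_pair => /=.
  - by apply: (@continuous_comp _ _ _ fst); [exact: cvg_fst|exact: cval].
  - by apply: (@continuous_comp _ _ _ snd); [exact: cvg_snd|exact: cval].
by apply: csub; exact: open_nbhs_nbhs.
Qed.
HB.instance Definition _ :=
  PreTopologicalNmodule_isTopologicalZmodule.Build subgroup
    subgroup_sub_continuous.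

End Subgroup.

(* Main.v *)
(* Let [E] be a scale: by [b = d], the proper initial segments of a suitable
   well-order index fewer than [b] functions, so [E] can be chosen dominating
   with fewer than [b] members not dominating any given [M].  For each [f] in
   [E] take the 0-1 sequence [gen f] whose support is a branch
   [0 = p 0 < p 1 < ...] of the tree of codes of finite sequences, growing
   faster than [f], and let [H] be the group they generate.

   - Elements of [H] are bounded by constants, so [H] is Hurewicz-bounded.
   - The entries of [h] in [H] at each level of the tree add up to [h 0], so
     [h 0 <> 0] forces a nonzero entry at every level; bounding its position
     gives covers that refute the Menger property, since [E] is dominating.
   - Given cylinders of lengths [m n], choose [tt] growing fast and split
     [h = h0 + y], where [y] collects the generators from those [f] in
     [E] that eventually dominate [a |-> tt (2 ^ a.+1)].  Then
     [y] vanishes on some [tt r, tt r.+1) inside every late block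
     [2 ^ j <= r < 2 ^ j.+1], so all finitely many patterns of [y] below
     [tt r] can be tried before [tt r.+1].  The remaining [h0] range over
     fewer than [cov(M)] sequences, hence a single sequence guesses each of
     them on infinitely many blocks. *)

Require Import Defs.
From HB Require Import structures.
From mathcomp Require Import all_boot all_order all_algebra.
From mathcomp Require Import all_classical all_reals all_analysis.
From mathcomp Require Import wochoice lra zify.

Import Order.TTheory GRing.Theory Num.Theory.
Import numFieldNormedType.Exports.

Local Open Scope classical_set_scope.
Local Open Scope card_scope.

(** * Eventual domination and families of fewer than b members *)

Lemma eventually_leP (f g : nat -> nat) :
  eventually_le f g <-> exists N, forall n, (N <= n)%N -> (f n <= g n)%N.
Proof.
split=> [[N _ fg]|[N fg]]; first by exists N => n /fg.
by exists N.
Qed.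

Lemma eventually_le_trans (f g h : nat -> nat) :
  eventually_le f g -> eventually_le g h -> eventually_le f h.
Proof. by apply: filterS2 => n; exact: leq_trans. Qed.

(* [small A] stands for [#|A| < b]; working with boundedness of families
   instead of cardinals replaces cardinal arithmetic by regularity of [b]. *)
Definition small {T : Type} (A : set T) : Prop :=
  forall phi : T -> nat -> nat,
  exists g, forall t, A t -> eventually_le (phi t) g.

Lemma small_sub {T : Type} (A A' : set T) : A `<=` A' -> small A' -> small A.
Proof.
by move=> AA' sA' phi; have [g gP] := sA' phi; exists g => t /AA' /gP.
Qed.

Lemma small_image {S T : Type} (f : S -> T) (A : set S) :
  small A -> small (f @` A).
Proof.
move=> sA phi; have [g gP] := sA (phi \o f).
by exists g => _ [s As <-]; exact: gP.
Qed.

(** Regularity of b: each piece has a bound, and these bounds, indexed by the small set [A], have a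
    common bound themselves. *)
Lemma small_bigcup {S T : Type} (A : set S) (F : S -> set T) :
  small A -> (forall s, A s -> small (F s)) -> small (\bigcup_(s in A) F s).
Proof.
move=> sA sF phi.
have /choice[G GP] (s : S) :
    exists g, A s -> forall t, F s t -> eventually_le (phi t) g.
  have [As|nAs] := pselect (A s); last by exists (fun=> 0%N).
  by have [g gP] := sF s As phi; exists g.
have [g gP] := sA G.
exists g => t [s As Fst].
exact: (eventually_le_trans _ _ _ (GP s As t Fst) (gP s As)).
Qed.

(** Diagonal bound: at [n] it adds up the functions whose index has code at most [n]. *)
Lemma small_countType {T : countType} (A : set T) : small A.
Proof.
move=> phi; exists (fun n => \sum_(i < n.+1)
  if unpickle i is Some t then phi t n else 0)%N => t _.
apply/eventually_leP; exists (pickle t) => n tn.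
by rewrite (bigD1 (Ordinal (tn : (pickle t < n.+1)%N))) //= pickleK leq_addr.
Qed.

Lemma small_setX {S T : Type} (A : set S) (A' : set T) :
  small A -> small A' -> small (A `*` A').
Proof.
move=> sA sA'.
apply: (@small_sub _ _ (\bigcup_(s in A) (pair s @` A'))).
  by move=> [s t] [/= As At]; exists s => //; exists t.
by apply: small_bigcup => // s _; exact: small_image.
Qed.

Lemma small_seq {T : eqType} (A : set T) :
  small A -> small [set s : seq T | forall t, t \in s -> A t].
Proof.
move=> sA.
apply: (@small_sub _ _ (\bigcup_(n in [set: nat])
    [set s : seq T | (forall t, t \in s -> A t) /\ size s = n])).
  by move=> s As; exists (size s).
apply: small_bigcup => [|n _]; first exact: small_countType.
elim: n => [|n IHn].
  apply: (@small_sub _ _ ((fun=> [::]) @` [set: unit])).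
    by move=> [|t s] [_ ?]; first by exists tt.
  by apply: small_image; exact: small_countType.
apply: (small_sub _ _ _ (small_image (fun ts => ts.1 :: ts.2) _
  (small_setX _ _ sA IHn))).
move=> [|t s] [As //= [sn]]; exists (t, s) => //=; split=> /=.
  by apply: As; exact: mem_head.
by split=> // u us; apply: As; rewrite inE us orbT.
Qed.

Lemma not_dominating_small (A : set (nat -> nat)) :
  small A -> ~ dominating A.
Proof.
move=> sA domA; have [g gP] := sA id.
have [f Af /eventually_leP[N Nf]] := domA (fun n => (g n).+1).
have /eventually_leP[N' N'f] := gP f Af.
have := Nf _ (leq_maxl N N'); have := N'f _ (leq_maxr N N').
by move=> /= h1 /leq_trans/(_ h1); rewrite ltnn.
Qed.

Lemma small_card_le {T : Type} (A : set T) (D : set (nat -> nat)) :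
  small A -> D #<= A -> small D.
Proof.
move=> sA /pcard_surjP[psi surj].
exact: small_sub surj (small_image _ _ sA).
Qed.

(** * Construction of the scale *)

Lemma scale_exists (B D : set (nat -> nat)) :
  least_card unbounded B -> dominating D -> D #<= B ->
  exists E : set (nat -> nat),
    (forall M, exists2 f, E f & forall k, (M k <= f k)%N) /\
    forall M, small [set f | E f /\ ~ eventually_le M f].
Proof.
move=> [_ Bmin] Ddom DB.
have [R woR] := well_ordering_principle (nat -> nat).
have Ranti : antisymmetric R.
  have woRT : wo_chain R predT := withinW woR.
  by move=> x y; exact: (wo_chain_antisymmetric woRT).
(* A non-small initial segment of [D], minimal when it is proper. *)
have [A nsA segA] : exists2 A : set (nat -> nat), ~ small A &
    forall i, A i -> small [set j | A j /\ ~ R i j].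
  pose bad : {pred nat -> nat} :=
    [pred i | `[< ~ small [set j | D j /\ ~ R i j] >]].
  have [[i0 bi0]|nbad] := pselect (nonempty bad); last first.
    exists D; first by move=> /not_dominating_small; apply.
    move=> i _; apply: contrapT => nsi; apply: nbad; exists i.
    exact: (introT (asboolP _) nsi).
  have [|i [[bi ilb] _]] := woR bad; first by exists i0.
  exists [set j | D j /\ ~ R i j]; first exact: (elimT (asboolP _) bi).
  move=> j [Dj nRij]; apply: (@small_sub _ _ [set k | D k /\ ~ R j k]).
    by move=> k [[]].
  apply: contrapT => nsj; apply: nRij; apply: ilb.
  exact: (introT (asboolP _) nsj).
(* A family over [A] without a common bound has an unbounded image, so [B], and with it [D], has at
   most the cardinality of [A]. *)
have DA : D #<= A.
  have [phi nphi] : exists phi : (nat -> nat) -> nat -> nat,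
      ~ exists g, forall t, A t -> eventually_le (phi t) g.
    exact/existsNP.
  apply: (card_le_trans DB); apply: (card_le_trans _ (card_image_le phi A)).
  by apply: Bmin => -[g gP]; apply: nphi; exists g => t At; apply: gP; exists t.
have /pcard_surjP[psi psi_surj] := DA.
(* Since [~ R i j] says that [j] strictly precedes [i], [F i] bounds all [psi j] with [j] up to and
   including [i]. *)
have /choice[F FP] (i : nat -> nat) :
    exists g, A i -> forall j, A j -> ~ R i j \/ i = j ->
      eventually_le (psi j) g.
  have [Ai|nAi] := pselect (A i); last by exists (fun=> 0%N).
  have [g gP] := segA i Ai psi.
  exists (fun n => maxn (g n) (psi i n)) => _ j Aj [nRij|<-].
    have /eventually_leP[N Ng] := gP j (conj Aj nRij).
    apply/eventually_leP; exists N => n /Ng /leq_trans; apply.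
    exact: leq_maxl.
  by apply/eventually_leP; exists 0%N => n _; exact: leq_maxr.
(* The maxima with constants turn eventual into everywhere domination. *)
pose F' (im : (nat -> nat) * nat) n := maxn (F im.1 n) im.2.
exists (F' @` (A `*` [set: nat])); split=> M.
  have [f /psi_surj[j Aj <-] Mj] := Ddom M.
  have /eventually_leP[N NF] :=
    eventually_le_trans _ _ _ Mj (FP j Aj j Aj (or_intror erefl)).
  exists (F' (j, \sum_(i < N) M i)%N).
    by exists (j, (\sum_(i < N) M i)%N).
  move=> k; rewrite /F'/= leq_max; have [/NF->//|kN] := leqP N k.
  by rewrite (bigD1 (Ordinal kN)) //= leq_addr orbT.
have [f /psi_surj[j Aj <-] Mj] := Ddom M.
(* As [psi j] dominates [M], so does every [F i] with [i] not before [j]; the exceptions come from a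
   proper initial segment. *)
apply: (@small_sub _ _ (F' @` ([set i | A i /\ ~ R j i] `*` [set: nat]))).
  move=> _ [[[i m] [/= Ai _] <-] nMF]; exists (i, m) => //.
  split=> //; split=> //= Rji; apply: nMF.
  have Fi : eventually_le (F i) (F' (i, m)).
    by apply/eventually_leP; exists 0%N => n _; exact: leq_maxl.
  apply: (eventually_le_trans _ _ _ _ Fi).
  apply: (eventually_le_trans _ _ _ Mj); apply: FP => //.
  have [->|ij] := pselect (i = j); [by right | left=> Rij; apply: ij].
  by apply: Ranti; rewrite Rij Rji.
apply: small_image; apply: small_setX; [exact: segA | exact: small_countType].
Qed.

(** * Guessing sequences infinitely often, from cov(M) *)

Section Guessing.
Variable R : realType.
Local Open Scope ring_scope.

(* Reading [v] off the fractional part of [u], every unit interval contains an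
   open interval for each of the infinitely many values of [v]. *)
Definition slot (v : nat) : set R :=
  \bigcup_(z in [set: int]) `]z%:~R + v.+2%:R^-1, z%:~R + v.+1%:R^-1[%classic.

Definition slot_index (u : R) : nat :=
  (Num.truncn (u - (Num.floor u)%:~R)^-1).-1.

Lemma slot_indexP (v : nat) (u : R) : slot v u -> slot_index u = v.
Proof.
move=> [z _] /=; rewrite in_itv/= => /andP[zu uz].
have v2_gt0 : (0 : R) < v.+2%:R^-1 by rewrite invr_gt0 ltr0n.
have v1_le1 : v.+1%:R^-1 <= 1 :> R by rewrite invf_le1 ?ltr0n// ler1n.
have [zu' uz' u1 u2 u_gt0] : [/\ z%:~R <= u, u < z%:~R + 1,
    v.+2%:R^-1 < u - z%:~R, u - z%:~R < v.+1%:R^-1 & 0 < u - z%:~R].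
  move: v2_gt0 v1_le1 zu uz; move: (v.+2%:R^-1) (v.+1%:R^-1) => a b *.
  by split; lra.
have -> : slot_index u = (Num.truncn (u - z%:~R)^-1).-1.
  rewrite /slot_index (_ : Num.floor u = z)//; apply: floor_def.
  by rewrite intrD mulr1z zu' uz'.
(* The reciprocal of the fractional part lies strictly between [v.+1] and [v.+2]. *)
suff -> : Num.truncn (u - z%:~R)^-1 = v.+1 by [].
apply: truncn_def; rewrite -[X in X <= _]invrK -[X in _ && (_ < X)]invrK.
by rewrite lef_pV2 ?ltf_pV2 ?posrE ?invr_gt0 ?ltr0n// (ltW u2).
Qed.

Lemma slot_open (v : nat) : open (slot v).
Proof. by apply: bigcup_open => z _; exact: interval_open. Qed.

Definition hits (phi : nat -> nat) (N : nat) : set R :=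
  \bigcup_(j in [set j | (N <= j)%N]) [set x | slot (phi j) (j%:R * x)].

Lemma hits_open (phi : nat -> nat) (N : nat) : open (hits phi N).
Proof.
apply: bigcup_open => j _; apply: open_comp (slot_open _) => x _.
exact: mulrl_continuous.
Qed.

(** Multiplication by [j] turns intervals of length [1 / j] into unit intervals, each of which meets
    every slot; it suffices that [1 / j < e]. *)
Lemma hits_dense (phi : nat -> nat) (N : nat) (x e : R) :
  0 < e -> exists2 y, ball x e y & hits phi N y.
Proof.
move=> e_gt0; pose j := maxn N.+1 (Num.bound e^-1).
have j_gt0 : 0 < j%:R :> R by rewrite ltr0n leq_max.
have je : j%:R^-1 < e.
  rewrite -[ltRHS]invrK ltf_pV2 ?posrE ?invr_gt0//.
  apply: (lt_le_trans (archi_boundP _)); first by rewrite invr_ge0 ltW.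
  by rewrite ler_nat leq_maxr.
pose v := phi j; pose c : R := (v.+2%:R^-1 + v.+1%:R^-1) / 2.
have v21 : v.+2%:R^-1 < v.+1%:R^-1 :> R.
  by rewrite ltf_pV2 ?posrE ?ltr0n// ltr_nat.
have v2_gt0 : (0 : R) < v.+2%:R^-1 by rewrite invr_gt0 ltr0n.
have v1_le1 : v.+1%:R^-1 <= 1 :> R by rewrite invf_le1 ?ltr0n// ler1n.
have [vc cv] : v.+2%:R^-1 < c /\ c < v.+1%:R^-1 by split; rewrite /c;
  move: v21 v2_gt0 v1_le1; move: (v.+2%:R^-1) (v.+1%:R^-1) => a b *; lra.
have [c_gt0 c_lt1] : 0 < c /\ c < 1.
  by split; [exact: lt_trans vc | exact: lt_le_trans cv _].
pose z := Num.floor (j%:R * x).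
have /andP[zl zu] := floor_itv (j%:R * x); rewrite intrD mulr1z in zu.
exists ((z%:~R + c) / j%:R); last first.
  exists j; first by apply: (leq_trans _ (leq_maxl _ _)).
  exists z => //=; rewrite in_itv/= mulrC divfK ?gt_eqF// -/v.
  by rewrite !ltrD2l vc.
rewrite /ball/= -[X in X - _](@mulfK _ j%:R) ?gt_eqF// -mulrBl normrM.
rewrite (gtr0_norm (_ : 0 < j%:R^-1)) ?invr_gt0//.
apply: le_lt_trans je; rewrite -[leRHS]mul1r ler_wpM2r ?invr_ge0 ?ltW//.
rewrite -/z in zl zu; rewrite mulrC in zl zu.
by rewrite ltr_norml; apply/andP; split; lra.
Qed.

Lemma nowhere_dense_setC_hits (phi : nat -> nat) (N : nat) :
  nowhere_dense (~` hits phi N).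
Proof.
rewrite /nowhere_dense -(closure_id _).1; last exact/open_closedC/hits_open.
rewrite -subset0 => x /nbhs_ballP[e /= e_gt0 xe].
by have [y /xe] := hits_dense phi N x e e_gt0.
Qed.

(* The meager set attached to [phi] consists of the reals whose digits
   [slot_index (j * x)] agree with [phi j] only finitely often. *)
Lemma guess {T : Type} (A : set T) (phi : T -> nat -> nat)
    (C : set (set R)) (D : set (nat -> nat)) :
  least_card (@meager_cover R) C -> dominating D -> D #<= C -> small A ->
  exists f : nat -> nat,
    forall t, A t -> forall N, exists2 j, (N <= j)%N & f j = phi t j.
Proof.
move=> [_ Cmin] Ddom DC sA.
pose M t := \bigcup_N ~` hits (phi t) N.
have [x xM] : exists x, forall t, A t -> ~ M t x.
  (* Otherwise the sets [M t] cover the line, so [D] has at most the cardinality of the small set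
     [A], yet is dominating. *)
  apply: contrapT => nx; apply: (not_dominating_small D) => //.
  apply: (small_card_le _ _ sA); apply: (card_le_trans DC).
  apply: (card_le_trans _ (card_image_le M A)); apply: Cmin; split.
    move=> _ [t _ <-]; exists (fun N => ~` hits (phi t) N) => // N.
    exact: nowhere_dense_setC_hits.
  rewrite -subTset => x _; apply: contrapT => nMx; apply: nx.
  exists x => t At Mx.
  by apply: nMx; exists (M t) => //; exists t.
exists (fun j => slot_index (j%:R * x)) => t At N.
have [j Nj jx] : hits (phi t) N x.
  by apply: contrapT => nh; apply: (xM t At); exists N.
by exists j => //; exact: slot_indexP.
Qed.

End Guessing.

(** * Branches of the tree of codes and their generators *)

Section Branches.
Implicit Types f : nat -> nat.

(** The new entry is [f] at the code of the sequence so far. A code exceeds each of its entries, so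
    every node of the branch lies beyond [f] of its predecessor. *)
Fixpoint stack f (n : nat) : seq nat :=
  if n is m.+1 then f (CodeSeq.code (stack f m)) :: stack f m else [::].

Definition branch f (n : nat) : nat := CodeSeq.code (stack f n).

Definition level (v : nat) : nat := size (CodeSeq.decode v).

Lemma level_branch f n : level (branch f n) = n.
Proof. by rewrite /level CodeSeq.codeK; elim: n => //= n ->. Qed.

Lemma branchS_gt f n : (f (branch f n) < branch f n.+1)%N.
Proof. by have /andP[] := CodeSeq.ltn_code (stack f n.+1). Qed.

Lemma branch_ltS f n : (branch f n < branch f n.+1)%N.
Proof.
rewrite {2}/branch /= -/(branch f n).
by rewrite -[leqLHS]mul1n leq_mul ?expn_gt0// ltnS -addnn leq_addr.
Qed.

Lemma branch_lt f : {homo branch f : m n / (m < n)%N}.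
Proof. by apply: homo_ltn; [exact: ltn_trans | exact: branch_ltS]. Qed.

Lemma branch_geq f n : (n <= branch f n)%N.
Proof. by elim: n => // n /leq_ltn_trans; apply; exact: branch_ltS. Qed.

Definition gen f : ZN := fun v => Posz (v == branch f (level v)).

Lemma gen_branch f n : gen f (branch f n) = 1%R.
Proof. by rewrite /gen level_branch eqxx. Qed.

Lemma gen_neq0 f v : gen f v != 0%R -> v = branch f (level v).
Proof. by rewrite /gen; case: (v =P _). Qed.

(** Two support points lie on different levels, and already the successor of [a] on the branch
    exceeds [f a]. *)
Lemma gen_gap f (a b : nat) :
  gen f a != 0%R -> gen f b != 0%R -> (a < b)%N -> (f a < b)%N.
Proof.
move=> /gen_neq0 va /gen_neq0 vb ab.
have ll : (level a < level b)%N.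
  rewrite ltnNge; apply/negP; rewrite leq_eqVlt => /orP[/eqP e|/(branch_lt f)].
    by move: ab; rewrite va vb e ltnn.
  by rewrite -va -vb ltnNge (ltnW ab).
rewrite vb {1}va; apply: leq_trans (branchS_gt _ _) _.
move: ll; rewrite leq_eqVlt => /orP[/eqP->//|/(branch_lt f)/ltnW //].
Qed.

End Branches.

(** * Integer combinations of generators *)

Section Combinations.
Local Open Scope ring_scope.
Implicit Types s : seq ((nat -> nat) * int).

Definition comb s : ZN := fun v => \sum_(t <- s) t.2 * gen t.1 v.

Definition comb_norm s : nat := (\sum_(t <- s) `|t.2|)%N.

Lemma comb_bound s v : (`|comb s v| <= comb_norm s)%N.
Proof.
rewrite /comb /comb_norm; elim: s => [|t s IH]; first by rewrite !big_nil.
have abszD (a b : int) : (`|(a + b)%R| <= `|a| + `|b|)%N by lia.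
rewrite !big_cons; apply: (leq_trans (abszD _ _)); apply: leq_add => //.
by rewrite abszM /gen; case: (_ == _); rewrite ?muln1 ?muln0.
Qed.

(* On [level v == n], each generator has exactly one nonzero entry, equal to
   1, so the entries of [comb s] there add up to [comb s 0]. *)
Lemma comb_level s n : comb s 0%N != 0 ->
  exists v, level v = n /\ comb s v != 0.
Proof.
move=> s0; apply: contrapT => nv; case/negP: s0; apply/eqP.
(* Large enough that the level-[n] nodes of all branches involved lie below [K]. *)
pose K := (\sum_(t <- s) (branch t.1 n).+1)%N.
have gen_sum t : t \in s ->
    \sum_(v < K | level v == n) gen t.1 v = 1 :> int.
  move=> ts; have tK : (branch t.1 n < K)%N.
    by rewrite /K (big_rem t)//= leq_addr.
  rewrite (bigD1 (Ordinal tK)) /= ?level_branch//= gen_branch.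
  rewrite big1 ?addr0// => v /andP[/eqP lv vne].
  apply/eqP/negPn/negP => /gen_neq0 vb.
  by case/negP: vne; apply/eqP/val_inj; rewrite /= {1}vb lv.
(* [0] codes the empty sequence, the root of every branch, so each generator takes the value 1
   there. *)
have -> : comb s 0%N = \sum_(v < K | level v == n) comb s v.
  rewrite /comb exchange_big /= [LHS]big_seq [RHS]big_seq.
  apply: eq_bigr => t ts; rewrite -mulr_sumr gen_sum//; congr (_ * _).
apply: big1 => v /eqP lv; apply/eqP/negPn/negP => sv; apply: nv.
by exists v.
Qed.

Definition span (E : set (nat -> nat)) : {pred ZN} :=
  fun h => `[< exists2 s, (forall t, t \in s -> E t.1) & h = comb s >].

Lemma span_gen E f : E f -> gen f \in span E.
Proof.
move=> Ef; apply/asboolP; exists [:: (f, 1)].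
  by move=> t; rewrite inE => /eqP->.
by apply/funext => v; rewrite /comb big_seq1 mul1r.
Qed.

Fact span_zmod_closed E : zmod_closed (span E).
Proof.
split.
  apply/asboolP; exists [::] => //.
  by apply/funext => v; rewrite /comb big_nil.
move=> x y /asboolP[s Es ->] /asboolP[s' Es' ->]; apply/asboolP.
exists (s ++ [seq (t.1, - t.2) | t <- s']).
  by move=> t; rewrite mem_cat => /orP[/Es//|/mapP[t' /Es' ? ->]].
apply/funext => v; rewrite -[LHS]/(comb s v - comb s' v).
rewrite /comb big_cat big_map /= -sumrN; congr (_ + _).
by apply: eq_bigr => t _; rewrite mulNr.
Qed.

HB.instance Definition _ E :=
  GRing.isZmodClosed.Build ZN (span E) (span_zmod_closed E).

End Combinations.

(** * Cylinder neighborhoods in subgroups *)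

Section SubgroupTopology.
Local Open Scope ring_scope.

(** The sets containing a cylinder around [x] form a filter, whose convergence to [x] in the product
    topology can be checked coordinatewise. *)
Lemma ZN_cylinder (x : ZN) (U : set ZN) : nbhs x U ->
  exists m, forall y : ZN, (forall i, (i < m)%N -> y i = x i) -> U y.
Proof.
pose F : set_system ZN :=
  [set A | exists m, forall y : ZN, (forall i, (i < m)%N -> y i = x i) -> A y].
have FF : Filter F.
  split; first by exists 0%N.
    move=> P Q [m mP] [m' mQ]; exists (maxn m m') => y yx.
    by split; [apply: mP | apply: mQ] => i im; apply: yx;
      apply: (leq_trans im); rewrite ?leq_maxl ?leq_maxr.
  by move=> P Q PQ [m mP]; exists m => y /mP /PQ.
suff : F --> x by apply.
apply/cvg_sup => i {}U [_ [[V _ <-] Vx VU]].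
exists i.+1 => y yx; apply: VU => /=.
by rewrite yx.
Qed.

Variable H : zmodClosed ZN.
Implicit Types h : subgroup H.

Definition coord h : nat -> int := subgroup_val h : ZN.

Lemma near_coord h (i : nat) :
  \forall y \near h, coord y i = coord h i.
Proof.
have /= cval : continuous (@subgroup_val ZN H).
  exact: initial_continuous.
exact: (cval h _ (near_ZN_coord (subgroup_val h) i)).
Qed.

Lemma nbhs0_cylinder (U : set (subgroup H)) : nbhs 0 U ->
  exists m, forall h, (forall i, (i < m)%N -> coord h i = 0) -> U h.
Proof.
move=> [_ [[W oW <-] W0 WU]].
have [|m mW] := ZN_cylinder 0 W.
  exact: open_nbhs_nbhs.
by exists m => h h0; apply: WU; apply: mW.
Qed.

(** Translations must use elements of the group, while the patterns to be tried are arbitrary;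
    [rep s m] realizes the pattern whenever some element does. *)
Lemma restriction_witness : exists rep : (nat -> int) -> nat -> subgroup H,
  forall h s m, (forall i, (i < m)%N -> coord h i = s i) ->
    forall i, (i < m)%N -> coord (rep s m) i = s i.
Proof.
have /choice[rep repP] (sm : (nat -> int) * nat) : exists g : subgroup H,
    forall h, (forall i, (i < sm.2)%N -> coord h i = sm.1 i) ->
    forall i, (i < sm.2)%N -> coord g i = sm.1 i.
  have [[h hP]|nh] := pselect (exists h : subgroup H,
    forall i, (i < sm.2)%N -> coord h i = sm.1 i); first by exists h.
  by exists 0 => h hP; exfalso; apply: nh; exists h.
by exists (fun s m => rep (s, m)) => h s m hs; exact: (repP (s, m) h hs).
Qed.

Lemma sumset_cylinder (A U : set (subgroup H)) (m : nat) (a h : subgroup H) :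
  (forall h, (forall i, (i < m)%N -> coord h i = 0) -> U h) -> A a ->
  (forall i, (i < m)%N -> coord h i = coord a i) -> sumset A U h.
Proof.
move=> mU Aa ha; exists a => //; exists (h - a); last by rewrite addrC subrK.
apply: mU => i im; have -> : coord (h - a) i = coord h i - coord a i.
  have hB : subgroup_val (h - a) = subgroup_val h - subgroup_val a :=
    raddfB (val : subgroup H -> ZN) h a.
  by rewrite /coord hB.
by rewrite ha// subrr.
Qed.

End SubgroupTopology.
Arguments coord {H}.

(** * Hurewicz- and Rothberger-boundedness *)

Section Boundedness.
Local Open Scope ring_scope.

Lemma span_comb (E : set (nat -> nat)) (h : subgroup (span E)) :
  exists2 s, (forall t, t \in s -> E t.1) & coord h = comb s.
Proof. by case: h => h hE; have /asboolP[s Es hs] := hE; exists s. Qed.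

Lemma span_hurewicz_bounded (E : set (nat -> nat)) :
  hurewicz_bounded (subgroup (span E)).
Proof.
move=> U U0; have [rep repP] := restriction_witness (span E).
have /choice[m mU] := fun n => nbhs0_cylinder _ _ (U0 n).
(* These are all patterns of length [m n] with entries from [-n] to [n]; they capture [h] once [n]
   reaches its norm. *)
pose decode n (sg : {ffun 'I_(m n) -> 'I_(n.*2.+1)}) (i : nat) : int :=
  if insub i is Some i' then Posz (sg i') - Posz n else 0.
exists (fun n => (fun sg => rep (decode n sg) (m n)) @` setT).
split=> [n|h]; first exact/finite_image/finite_finset.
have [s _ hs] := span_comb _ h.
exists (comb_norm s) => // n /= sn.
pose sg : {ffun 'I_(m n) -> 'I_(n.*2.+1)} :=
  [ffun i : 'I_(m n) => inord `|(coord h i + Posz n)%R|%N].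
have sgh i : (i < m n)%N -> coord h i = decode n sg i.
  have bnd : (`|coord h i| <= comb_norm s)%N by rewrite hs comb_bound.
  move=> im; rewrite /decode insubT ffunE /= inordK.
    by move: (coord h i) sn bnd => c sn bnd; lia.
  by move: (coord h i) sn bnd => c sn bnd; lia.
apply: (sumset_cylinder _ _ _ _ (rep (decode n sg) (m n)) _ (mU n)).
  by exists sg.
by move=> i im; rewrite (repP h)// sgh.
Qed.

Lemma comb_gap (s : seq ((nat -> nat) * int)) (tt : nat -> nat) (K j : nat) :
  {homo tt : m n / (m < n)%N} ->
  (forall t, t \in s -> forall a, (K <= a)%N -> (tt (2 ^ a.+1) <= t.1 a)%N) ->
  (K <= j)%N -> (size s <= j)%N ->
  exists2 r, (2 ^ j <= r < 2 ^ j.+1)%N &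
    forall i, (tt r <= i < tt r.+1)%N -> comb s i = 0.
Proof.
move=> tt_lt sK Kj sj; apply: contrapT => ngap.
have tt_le : {homo tt : m n / (m <= n)%N}.
  by move=> m n; rewrite leq_eqVlt => /orP[/eqP->//|/tt_lt/ltnW].
have tt_ge n : (n <= tt n)%N.
  by elim: n => // n /leq_ltn_trans; apply; exact: tt_lt.
(* Otherwise each of the [2 ^ j] intervals meets the support of one of the at
   most [j] generators, while each generator meets at most one of them. *)
have hit (r : 'I_(2 ^ j)) : exists ic : nat * 'I_(size s),
    (tt (2 ^ j + r) <= ic.1 < tt (2 ^ j + r).+1)%N /\
    gen (nth (id, 0) s ic.2).1 ic.1 != 0.
  apply: contrapT => nhit; apply: ngap; exists (2 ^ j + r)%N.
    by rewrite leq_addr expnS mul2n -addnn ltn_add2l /=.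
  move=> i ir; rewrite /comb (big_nth (id, 0)) big_mkord big1// => c _.
  have [->|gn0] := eqVneq (gen (nth (id, 0) s c).1 i) 0; first by rewrite mulr0.
  by exfalso; apply: nhit; exists (i, c).
have /choice[ic icP] := hit.
suff /leq_card : injective (fun r => (ic r).2).
  by rewrite !card_ord => /leq_trans/(_ sj); rewrite leqNgt ltn_expl.
(* A first support point [a] in the block satisfies [j <= a], so the next one exceeds [t.1 a], hence
   [tt (2 ^ a.+1)], and lies past the end of the block. *)
have noclash (r r' : 'I_(2 ^ j)) : (r < r')%N -> (ic r).2 <> (ic r').2.
  move=> rr' e.
  have [/andP[l1 u1] g1] := icP r; have [/andP[l2 u2] g2] := icP r'.
  rewrite e in g1; set t := nth _ _ _ in g1 g2.
  have lt12 : ((ic r).1 < (ic r').1)%N.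
    apply: (leq_trans u1); apply: leq_trans l2; apply: tt_le.
    by rewrite ltn_add2l.
  have j1 : (j <= (ic r).1)%N.
    apply: leq_trans l1; apply: leq_trans (tt_ge _).
    apply: leq_trans (leq_addr _ _).
    exact/ltnW/ltn_expl.
  have := gen_gap _ _ _ g1 g2 lt12; apply/negP; rewrite -leqNgt.
  apply: ltnW; apply: (leq_trans u2).
  apply: leq_trans (sK t _ _ (leq_trans Kj j1)); last by rewrite mem_nth.
  apply: tt_le; apply: (@leq_trans (2 ^ j.+1)); last by rewrite leq_exp2l.
  by rewrite expnS mul2n -addnn ltn_add2l.
by move=> r r' e; apply/val_inj/eqP; case: ltngtP => // /noclash; case.
Qed.

(** Only finitely many sequences qualify; the bounds for all possible heads, of either sign, are
    added up. *)
Lemma bounded_seq_max (F : seq int -> nat) (r t : nat) :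
  exists M, forall s, size s = t -> (forall x, x \in s -> (`|x| <= r)%N) ->
    (F s <= M)%N.
Proof.
elim: t F => [|t IHt] F.
  by exists (F [::]) => s /size0nil->.
have /choice[G GP] := fun x : int => IHt (fun s => F (x :: s)).
exists (\sum_(i < r.+1) (G (Posz i) + G (- Posz i)))%N => -[//|x s] [ss] sr.
have xr : (`|x| < r.+1)%N by apply: sr; exact: mem_head.
have /leq_trans : (F (x :: s) <= G x)%N.
  by apply: GP => // y ys; apply: sr; rewrite inE ys orbT.
apply; rewrite (bigD1 (Ordinal xr)) //= (leq_trans _ (leq_addr _ _))//.
have [x0|x0] := leP 0 x.
  by rewrite gez0_abs// leq_addr.
by rewrite lez0_abs ?opprK ?leq_addl// ltW.
Qed.

Lemma span_rothberger_bounded (E : set (nat -> nat)) :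
  (forall M, small [set f | E f /\ ~ eventually_le M f]) ->
  (forall (A : set (seq ((nat -> nat) * int))) (phi : _ -> nat -> nat),
    small A -> exists f : nat -> nat,
    forall s, A s -> forall N, exists2 j, (N <= j)%N & f j = phi s j) ->
  rothberger_bounded (subgroup (span E)).
Proof.
move=> smallE guessing U U0; have [rep repP] := restriction_witness (span E).
have /choice[m mU] := fun n => nbhs0_cylinder _ _ (U0 n).
have /choice[T' T'P] := fun rt : nat * nat => bounded_seq_max
  (fun s : seq int => \sum_(j < rt.1.+1) m (pickle (j : nat, s)))%N rt.1 rt.2.
have [T TP] : exists T : nat -> nat -> nat,
    forall r (j : nat) (s : seq int), (j <= r)%N ->
    (forall x, x \in s -> (`|x| <= r)%N) ->
    (m (pickle (j, s)) <= T r (size s))%N.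
  exists (fun r t => T' (r, t)) => r j s jr sr.
  apply: leq_trans (T'P (r, size s) s erefl sr).
  by rewrite (bigD1 (Ordinal (jr : (j < r.+1)%N)))//= leq_addr.
(* [tt r.+1] is at least the length of every cylinder attached to a code [(j, s)] with [j <= r],
   [size s = tt r] and entries of [s] bounded by [r]. *)
pose tt := fix tt r :=
  if r is r'.+1 then ((tt r').+1 + T r' (tt r'))%N else 0%N.
have tt_lt : {homo tt : m n / (m < n)%N}.
  by apply: homo_ltn => [? ? ?|n]; [exact: ltn_trans | rewrite /= leq_addr].
have tt_le : {homo tt : m n / (m <= n)%N}.
  by move=> a b; rewrite leq_eqVlt => /orP[/eqP->//|/tt_lt/ltnW].
pose M a := tt (2 ^ a.+1)%N.
pose bad : set (nat -> nat) := [set f | E f /\ ~ eventually_le M f].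
(* The guessed number codes all values of the combination up to the end of block [j]. *)
have [f fP] := guessing [set s | forall t, t \in s -> (bad `*` [set: int]) t]
  (fun s j => pickle (mkseq (comb s) (tt (2 ^ j.+1)%N)))
  (small_seq _ (small_setX _ _ (smallE M) (small_countType _))).
pose G j i : int := nth 0 (odflt [::] (unpickle (f j))) i.
(* The [n]-th attempt, [n] coding [(j, s)], bets on the guess [G j] for [h0]
   and on the pattern [s] for [y]. *)
exists (fun n => if unpickle n is Some (j, s)
  then rep (fun i => G j i + nth 0 s i) (m n) else 0).
rewrite -subTset => h _; have [s sE hs] := span_comb _ h.
pose s0 := [seq t <- s | `[< bad t.1 >]].
pose s1 := [seq t <- s | ~~ `[< bad t.1 >]].
have hs01 i : coord h i = comb s0 i + comb s1 i.
  by rewrite hs /comb !big_filter (bigID (fun t => `[< bad t.1 >])).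
have [K s1K] : exists K, forall t, t \in s1 ->
    forall a, (K <= a)%N -> (M a <= t.1 a)%N.
  have : forall t, t \in s1 -> eventually_le M t.1.
    move=> t; rewrite mem_filter => /andP[/asboolP nb /sE Et].
    by apply: contrapT => nM; apply: nb.
  elim: s1 {hs01} => [|t s' IHs'] s'M; first by exists 0%N.
  have [|K s'K] := IHs'.
    by move=> u us'; apply: s'M; rewrite inE us' orbT.
  have /eventually_leP[K' tK'] := s'M t (mem_head _ _).
  exists (maxn K K') => u; rewrite inE => /orP[/eqP->|us'] a;
    rewrite geq_max => /andP[Ka K'a].
    exact: tK'.
  exact: s'K.
have [|j] := fP s0 _ (K + size s1 + comb_norm s1)%N.
  by move=> t; rewrite mem_filter => /andP[/asboolP].
move=> jlarge fj.
have [Kj szj nj] : [/\ K <= j, size s1 <= j & comb_norm s1 <= j]%N.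
  by split; lia.
have [r /andP[jr rj] gap] := comb_gap _ _ _ _ tt_lt s1K Kj szj.
pose sg := mkseq (comb s1) (tt r); pose n := pickle (j, sg).
have mn : (m n <= tt r.+1)%N.
  have jr' : (j <= r)%N by apply: leq_trans jr; exact/ltnW/ltn_expl.
  apply: (@leq_trans (T r (tt r))); last by rewrite /= leq_addl.
  rewrite -[tt r](size_mkseq (comb s1)); apply: TP => // x /mapP[i _ ->].
  exact: (leq_trans (comb_bound _ _) (leq_trans nj jr')).
exists n => //; apply: (sumset_cylinder _ _ _ _ _ _ (mU n)); first by [].
have hG i : (i < m n)%N -> coord h i = G j i + nth 0 sg i.
  move=> im; have itt : (i < tt r.+1)%N by exact: leq_trans mn.
  rewrite hs01 /G fj pickleK /= nth_mkseq; last first.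
    by apply: (leq_trans itt); apply: tt_le.
  congr (_ + _); have [ir|ri] := ltnP i (tt r); first by rewrite nth_mkseq.
  (* Beyond its length [tt r], [sg] reads as the default 0, which is the value of [comb s1] on the
     gap. *)
  by rewrite nth_default ?size_mkseq// gap// ri.
by rewrite /n pickleK => i im; rewrite (repP h)// hG.
Qed.

End Boundedness.

(** * Failure of the Menger property *)

Section NotMenger.
Local Open Scope ring_scope.

Lemma finite_sub_range {T : Type} (V : nat -> set T) (F : set (set T)) :
  {homo V : k l / (k <= l)%N >-> k `<=` l} ->
  finite_set F -> F `<=` range V -> exists k, \bigcup_(U in F) U `<=` V k.
Proof.
move=> Vmono /finite_seqP[X ->] XV.
have /choice[idx idxP] (U : set T) : exists k, U \in X -> U = V k.
  have [UX|nUX] := boolP (U \in X); last by exists 0%N.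
  by have [k _ <-] := XV U UX; exists k.
exists (\max_(U <- X) idx U)%N => x [U UX Ux].
by apply: (Vmono (idx U)); [exact: leq_bigmax_seq | rewrite -idxP].
Qed.

Lemma span_not_menger (E : set (nat -> nat)) :
  (forall M, exists2 f, E f & forall k, (M k <= f k)%N) ->
  ~ menger (subgroup (span E)).
Proof.
move=> domE men.
(* Level [n.+1] is used because the node there is forced beyond [f (branch f n)]. *)
pose V n k : set (subgroup (span E)) := [set h | coord h 0%N = 0 \/
  exists v, [/\ (v <= k)%N, level v = n.+1 & coord h v != 0]].
have Vmono n : {homo V n : k l / (k <= l)%N >-> k `<=` l}.
  move=> k l kl h [h0|[v [vk lv hv]]]; first by left.
  by right; exists v; split=> //; exact: leq_trans kl.
have cover n : open_cover (range (V n)).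
  split=> [_ [k _ <-]|].
    rewrite openE => h [h0|[v [vk lv hv]]].
      by near=> g; left; rewrite -h0; near: g; exact: near_coord.
    near=> g; right; exists v; split=> //.
    suff -> : coord g v = coord h v by [].
    by near: g; exact: near_coord.
  rewrite -subTset => h _; have [s _ hs] := span_comb _ h.
  have [h0|h0] := eqVneq (coord h 0%N) 0.
    by exists (V n 0%N); [exists 0%N | left].
  have [v [lv hv]] : exists v, level v = n.+1 /\ comb s v != 0.
    by apply: comb_level; rewrite -hs.
  by exists (V n v); [exists v | right; exists v; rewrite hs].
have [F [FV Fcov]] := men _ cover.
have /choice[g gP] n : exists k, \bigcup_(U in F n) U `<=` V n k.
  by have [Ffin Frange] := FV n; exact: finite_sub_range.
(* The bound will be used at [branch f n >= n] instead of [n]; summing makes it cover [g n] there as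
   well. *)
have [f Ef fP] := domE (fun a => \sum_(n < a.+1) g n)%N.
have [n _ /gP[h0|[v [vk lv hv]]]] : (\bigcup_n \bigcup_(U in F n) U)
    (Subgroup (span_gen _ _ Ef)) by rewrite Fcov.
  by have := gen_branch f 0; rewrite [LHS]h0.
have vb : v = branch f n.+1 by rewrite -lv; exact: gen_neq0.
have := branchS_gt f n; rewrite -vb ltnNge => /negP; apply.
apply: (leq_trans vk); apply: leq_trans (fP _).
have nb : (n < (branch f n).+1)%N by exact: branch_geq.
by rewrite (bigD1 (Ordinal nb))//= leq_addr.
Unshelve. all: by end_near. Qed.

End NotMenger.

(** * Implications between the properties, and the conclusion *)

Section Implications.

Lemma hurewicz_boundedW (G : topologicalZmodType) :
  hurewicz_bounded G -> menger_bounded G.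
Proof.
move=> hG U U0; have [F [Ffin FP]] := hG U U0; exists F; split=> //.
by rewrite -subTset => g _; have [N _ /(_ N (leqnn N))] := FP g; exists N.
Qed.

Lemma hurewiczW (X : topologicalType) : hurewicz X -> menger X.
Proof.
move=> hX C C_cover; have [F [FC FP]] := hX C C_cover; exists F; split=> //.
by rewrite -subTset => x _; have [N _ /(_ N (leqnn N))] := FP x; exists N.
Qed.

Lemma rothbergerW (X : topologicalType) : rothberger X -> menger X.
Proof.
move=> rX C C_cover; have [U [CU UT]] := rX C C_cover.
exists (fun n => [set U n]); split=> [n|].
  by split; [exact: finite_set1 | move=> _ ->].
by rewrite -UT; apply: eq_bigcupr => n _; rewrite bigcup_set1.
Qed.

End Implications.

Theorem theorem9p7 (R : realType)
    (C : set (set R)) (B D : set (nat -> nat))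
    (covM : least_card (@meager_cover R) C)
    (b : least_card unbounded B)
    (d : least_card dominating D)
    (covM_eq_b : C #= B) (b_eq_d : B #= D) :
  exists H : zmodClosed ZN,
    [/\ hurewicz_bounded (subgroup H),
        menger_bounded (subgroup H) &
        rothberger_bounded (subgroup H)] /\
    [/\ ~ hurewicz (subgroup H),
        ~ menger (subgroup H) &
        ~ rothberger (subgroup H)].
Proof.
have [Ddom _] := d.
have [BD DB] := (card_eqPle _ _).1 b_eq_d.
have DC : D #<= C.
  by apply: (card_le_trans DB); have [_ BC] := (card_eqPle _ _).1 covM_eq_b.
have [E [domE smallE]] := scale_exists _ _ b Ddom DB.
have nmen := span_not_menger _ domE.
have hb := span_hurewicz_bounded E.
exists (span E : zmodClosed ZN); split; split.
- exact: hb.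
- exact: hurewicz_boundedW.
- apply: span_rothberger_bounded => // A phi; exact: guess covM Ddom DC.
- by move=> /hurewiczW.
- exact: nmen.
- by move=> /rothbergerW.
Qed.
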